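(* The largest $N$ for which $t(N) \geq N/4$ can be demonstrated purely by rearranging powers of $2$ and $3$ in the standard factorization $N! = \prod\{1,\dots,N\}$ is $26244$; that is, $t_{2,3}(26244) \geq 26244/4$, and $t_{2,3}(N) < N/4$ for every $N > 26244$.
   Context: Call a natural number $3$-smooth if it is of the form $2^a3^b$ with integers $a,b\geq 0$, and $3$-rough if it is coprime to $6$. Each $n\in\{1,\dots,N\}$ factors uniquely as $n = d_n m_n$ with $d_n$ $3$-smooth and $m_n$ $3$-rough. Define $t_{2,3}(N)$ to be the largest $t$ for which there exist $3$-smooth natural numbers $\ell_1,\dots,\ell_N$ such that $\ell_1\cdots\ell_N$ divides $d_1\cdots d_N$ and $\ell_n m_n \geq t$ for all $1\le n\le N$ (i.e., the largest $t$ for which a $t$-admissible factorization or subfactorization of $N!$ into $N$ factors can be obtained from $\{1,\dots,N\}$ by rearranging only powers of $2$ and $3$). *)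

(* Defs.v *)
From mathcomp Require Import all_boot.
From mathcomp Require Import boolp.

Set Implicit Arguments.
Unset Strict Implicit.
Unset Printing Implicit Defensive.

Definition smooth3 (n : nat) : Prop := exists a b : nat, n = 2 ^ a * 3 ^ b.

Definition rough3 (n : nat) : bool := coprime n 6.

Definition pi23 : nat_pred := [pred p | (p == 2) || (p == 3)].

(* The factorization n = d_n m_n, see [smooth_rough_factP]. *)
Definition smooth_part (n : nat) : nat := n`_pi23.

Definition rough_part (n : nat) : nat := n`_pi23^'.

Lemma smooth3E (n : nat) : smooth3 n <-> pi23.-nat n.
Proof.
split=> [[a [b ->]]|n23].
  by rewrite pnatM !pnatX; apply/andP; split; apply/orP; left.
have n_gt0 : 0 < n by case/andP: n23.
exists (logn 2 n), (logn 3 n).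
rewrite -[LHS](part_pnat_id n23) -!p_part.
have -> : n`_2 * n`_3 = n`_pi23`_2 * n`_pi23`_2^'; last by rewrite partnC.
congr (_ * _); first by rewrite (part_pnat_id n23).
rewrite (part_pnat_id n23); apply: eq_in_partn => p /(pnatPpi n23).
by rewrite !inE => /orP[]/eqP->.
Qed.

Lemma rough3E (n : nat) : 0 < n -> rough3 n = pi23^'.-nat n.
Proof.
move=> n_gt0; rewrite /rough3 coprime_sym coprime_pi' //.
by apply: eq_pnat => p; rewrite !inE.
Qed.

Lemma smooth_rough_factP (n d m : nat) : 0 < n ->
  [/\ smooth3 d, rough3 m & n = d * m]
    <-> d = smooth_part n /\ m = rough_part n.
Proof.
move=> n_gt0; split=> [[/smooth3E d23 m23 def_n]|[-> ->]]; last first.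
  split; first by apply/smooth3E; apply: part_pnat.
    by rewrite rough3E ?part_gt0 ?part_pnat.
  by rewrite partnC.
move: (n_gt0); rewrite def_n muln_gt0 => /andP[d_gt0 m_gt0].
move: m23; rewrite rough3E // => m23.
rewrite /smooth_part /rough_part !partnM //.
rewrite (part_pnat_id d23) (part_pnat_id m23) (part_p'nat m23).
by rewrite (@part_p'nat pi23^' d) ?pnatNK // muln1 mul1n.
Qed.

Definition subfactorization23 (N t : nat) : Prop :=
  exists l : nat -> nat,
    [/\ forall n, 1 <= n <= N -> smooth3 (l n),
        \prod_(1 <= n < N.+1) l n %| \prod_(1 <= n < N.+1) smooth_part n
      & forall n, 1 <= n <= N -> t <= l n * rough_part n].

(* By [subfactorization23_le] the range t <= N loses nothing when N > 0, so this
   is the largest t (see [t23P]); for N = 0 every t qualifies, and t23 0 = 0. *)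
Definition t23 (N : nat) : nat :=
  \max_(t < N.+1 | `[< subfactorization23 N t >]) t.

Lemma subfactorization23_le (N t : nat) :
  0 < N -> subfactorization23 N t -> t <= N.
Proof.
move=> N_gt0 [l [_ l_dvd l_ge]]; rewrite -(leq_exp2r _ _ N_gt0).
have prodE c : c ^ N = \prod_(1 <= n < N.+1) c.
  by rewrite prod_nat_const_nat subn1.
apply: (@leq_trans (\prod_(1 <= n < N.+1) (l n * rough_part n))).
  rewrite prodE big_nat_cond [leqRHS]big_nat_cond.
  by apply: leq_prod => n /andP[n_N _]; apply: l_ge.
apply: (@leq_trans (\prod_(1 <= n < N.+1) (smooth_part n * rough_part n))).
  rewrite !big_split leq_mul2r; apply/orP; right; apply: dvdn_leq l_dvd.
  by apply: prodn_gt0 => n; apply: part_gt0.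
rewrite prodE big_nat_cond [leqRHS]big_nat_cond.
apply: leq_prod => n /andP[/andP[n_gt0 n_leN] _].
by rewrite /smooth_part /rough_part partnC.
Qed.

Lemma t23P (N : nat) : 0 < N ->
  subfactorization23 N (t23 N)
    /\ forall t, subfactorization23 N t -> t <= t23 N.
Proof.
move=> N_gt0; split=> [|t Nt].
  rewrite /t23.
  have N0 : `[< subfactorization23 N (@ord0 N) >].
    apply/asboolP; exists (fun=> 1); split=> // [n _|]; first by exists 0, 0.
    by rewrite big1_eq dvd1n.
  have: 0 < #|[pred t : 'I_N.+1 | `[< subfactorization23 N t >]]|.
    by apply/card_gt0P; exists ord0.
  by case/(eq_bigmax_cond (@nat_of_ord N.+1)) => t /asboolP Nt ->.
have lt_t : t < N.+1 by rewrite ltnS (subfactorization23_le N_gt0).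
by apply: (bigmax_sup (Ordinal lt_t)) => //; apply/asboolP.
Qed.

(* Main.v *)
(* Give a 3-smooth number 2^a 3^b the weight 2a + 3b, the optimal dual weights of the
   linear program behind t_{2,3}. If [N <= 4 t], then l_n >= N / (4 m_n) forces a lower
   bound on the weight of l_n, since the largest 3-smooth number U_k of weight at most k
   is explicit: the weight of l_n exceeds k whenever 4 U_k m_n < N. Summing over n, the
   total weight is at least the sum over k of the number of n <= N with 4 U_k m_n < N,
   and this number is at least the sum over 3-smooth s of the number of 3-rough integers
   up to min (N / s, (N - 1) / (4 U_k)). With finitely many k and s this demand is still
   a little larger than 7N/2, hence than the available weight
   2 v_2(N!) + 3 v_3(N!) <= 7N/2, once N >= 2140000; the smaller N > 26244 are checked
   by computation. For N = 26244, with N / 4 = 3^8, an explicit choice of l_n as a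
   function of m_n works. *)

From Stdlib Require Import ZArith.
Require Import Defs.
From mathcomp Require Import all_boot all_order all_algebra.
From mathcomp Require Import zify.
Import Order.TTheory GRing.Theory Num.Theory.

Set Implicit Arguments.
Unset Strict Implicit.
Unset Printing Implicit Defensive.

Local Open Scope nat_scope.
Delimit Scope Z_scope with Z.

(** * Weights of 3-smooth numbers *)

Definition weight (n : nat) : nat := 2 * logn 2 n + 3 * logn 3 n.

Lemma weightM (m n : nat) : 0 < m -> 0 < n -> weight (m * n) = weight m + weight n.
Proof. by move=> m_gt0 n_gt0; rewrite /weight !lognM //; lia. Qed.

Lemma weight_prod (I : Type) (s : seq I) (F : I -> nat) :
  (forall i, 0 < F i) -> weight (\prod_(i <- s) F i) = \sum_(i <- s) weight (F i).
Proof.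
move=> F_gt0; elim: s => [|i s IHs]; first by rewrite !big_nil /weight !logn1.
by rewrite !big_cons weightM ?IHs ?prodn_gt0.
Qed.

Lemma weight_dvd (m n : nat) : 0 < n -> m %| n -> weight m <= weight n.
Proof.
move=> n_gt0 m_n; have le p := dvdn_leq_log p n_gt0 m_n.
by rewrite leq_add // leq_mul2l le.
Qed.

Lemma weight_smooth (a b : nat) : weight (2 ^ a * 3 ^ b) = 2 * a + 3 * b.
Proof.
rewrite weightM ?expn_gt0 // /weight !lognX !(@logn_prime _ 2) ?(@logn_prime _ 3) //=.
lia.
Qed.

Definition val23 (p : nat * nat) : nat := 2 ^ p.1 * 3 ^ p.2.

Lemma val23_gt0 (p : nat * nat) : 0 < val23 p.
Proof. by rewrite muln_gt0 !expn_gt0. Qed.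

Lemma val23_inj : injective val23.
Proof.
move=> [a b] [c d] eq_v; have := congr1 (logn 2) eq_v; have := congr1 (logn 3) eq_v.
rewrite /val23 !lognM ?expn_gt0 // !lognX !(@logn_prime _ 2) ?(@logn_prime _ 3) //=.
by move=> eq_b eq_a; congr (_, _); lia.
Qed.

(* Exponents of the largest 3-smooth number of weight at most [k]. *)
Definition weight_bound (k : nat) : nat * nat :=
  if k == 1 then (0, 0)
  else if k %% 3 == 0 then (0, k %/ 3)
  else if k %% 3 == 1 then (2, k %/ 3 - 1) else (1, k %/ 3).

Lemma weight_bound_ge (a b k : nat) :
  2 * a + 3 * b <= k -> 2 ^ a * 3 ^ b <= val23 (weight_bound k).
Proof.
(* 2^3 < 3^2 while both have weight 6, so one may assume a < 3. *)
have [n] := ubnP a; elim: n a b => // n IHn a b lt_an le_k.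
have [a_ge3|a_lt3] := leqP 3 a.
  apply: leq_trans _ (IHn (a - 3) (b + 2) _ _); try lia.
  have -> : a = a - 3 + 3 by lia.
  by rewrite addnK !expnD; nia.
have k_eq := divn_eq k 3; have : k %% 3 < 3 by rewrite ltn_mod.
have le3 c d : c <= d -> 3 ^ c <= 3 ^ d by move=> ?; rewrite leq_exp2l.
rewrite /weight_bound; case: eqP => [k1 _|k_neq1].
  by have [-> ->] : a = 0 /\ b = 0 by lia.
rewrite /val23; case: eqP => [r0 _|_] /=.
  case: a a_lt3 {lt_an} le_k => [|[|[|]]] // _ le_k.
  - by have := le3 b (k %/ 3); lia.
  - by have := le3 b.+1 (k %/ 3); rewrite expnS; lia.
  - by have := le3 b.+2 (k %/ 3); rewrite !expnS; lia.
case: eqP => [r1 _|r_neq1 r_lt] /=.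
  (* As [k = 1] is excluded, [k %/ 3 - 1] is a true subtraction. *)
  have [q k_eq_q] : exists q, k = 3 * q + 4 by exists (k %/ 3 - 1); lia.
  have -> : k %/ 3 - 1 = q by lia.
  case: a a_lt3 {lt_an} le_k => [|[|[|]]] // _ le_k.
  - by have := le3 b q.+1; rewrite expnS; lia.
  - by have := le3 b q; lia.
  - by have := le3 b q; lia.
case: a a_lt3 {lt_an} le_k => [|[|[|]]] // _ le_k.
- by have := le3 b (k %/ 3); lia.
- by have := le3 b (k %/ 3); lia.
- by have := le3 b.+1 (k %/ 3); rewrite !expnS; lia.
Qed.

(** By [weight_bound_ge], a 3-smooth [n] above the [k]-th bound has weight more than [k], so only
    indices below [weight n] are counted. *)
Lemma count_weight_bound_lt (K n : nat) :
  smooth3 n -> count (fun k => val23 (weight_bound k) < n) (iota 0 K) <= weight n.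
Proof.
case=> a [b def_n]; apply: (@leq_trans (count (fun k => k < weight n) (iota 0 K))).
  apply: sub_count => k lt_kn; rewrite ltnNge; apply: contraL lt_kn.
  by rewrite -leqNgt def_n weight_smooth; apply: weight_bound_ge.
elim: K => // K; rewrite -(addn1 K) iotaD count_cat add0n /= addn0.
have := count_size (fun k => k < weight n) (iota 0 K); rewrite size_iota.
by case: ltnP; lia.
Qed.

(** * Counting integers by their 3-rough part *)

Definition rough_count (x : nat) : nat := (x + 5) %/ 6 + (x + 1) %/ 6.

Lemma rough_countE (x : nat) : count rough3 (iota 1 x) = rough_count x.
Proof.
elim: x => // x; rewrite -(addn1 x) iotaD count_cat => -> /=.
rewrite addn0 add1n /rough3 -coprime_modl /rough_count.
have := divn_eq x.+1 6; have : x.+1 %% 6 < 6 by rewrite ltn_mod.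
by case: (x.+1 %% 6) => [|[|[|[|[|[|]]]]]] //= _ def_x; rewrite /coprime /=; lia.
Qed.

(** The worst quotients are 4 modulo 6, just before the next 3-rough number. The slack [n <= x.+1]
    lets [n = N] serve both [x = N] and [x = N - 1]. *)
Lemma rough_count_ge (n x s : nat) : 0 < s -> n <= x.+1 ->
  n <= s * (3 * rough_count (x %/ s) + 2).
Proof.
move=> s_gt0 n_le; set q := x %/ s.
have x_lt : x < s * q.+1 by rewrite mulnC ltn_ceil.
have : q.+1 <= 3 * rough_count q + 2 by rewrite /rough_count; lia.
by move/(leq_mul (leqnn s)); lia.
Qed.

Lemma leq_rough_count (x y : nat) : x <= y -> rough_count x <= rough_count y.
Proof. by rewrite /rough_count; lia. Qed.

(** Each [s] in [Ss] and 3-rough [m] up to the minimum give a product [s * m <= N] with rough part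
    [m]; unique factorization makes these products distinct. *)
Lemma count_rough_part_ge (N X : nat) (Ss : seq nat) :
  uniq Ss -> (forall s, s \in Ss -> smooth3 s) ->
  \sum_(s <- Ss) rough_count (minn (N %/ s) X)
    <= count (fun n => rough_part n <= X) (iota 1 N).
Proof.
move=> uniqS smoothS.
pose t s := [seq m <- iota 1 (minn (N %/ s) X) | rough3 m].
have S_gt0 s : s \in Ss -> 0 < s.
  by case/smoothS=> a [b ->]; rewrite muln_gt0 !expn_gt0.
have parts s m : s \in Ss -> m \in t s ->
    [/\ 0 < s * m <= N, smooth_part (s * m) = s, rough_part (s * m) = m & m <= X].
  move=> Ss_s; rewrite mem_filter mem_iota => /andP[rough_m m_lt].
  have s_gt0 := S_gt0 s Ss_s.
  have sm_gt0 : 0 < s * m by rewrite muln_gt0 s_gt0; lia.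
  have [|<- <-] // := (smooth_rough_factP s m sm_gt0).1.
    by split=> //; apply: smoothS.
  split=> //; last by lia.
  rewrite sm_gt0 mulnC -leq_divRL //; lia.
have -> : \sum_(s <- Ss) rough_count (minn (N %/ s) X)
    = size [seq s * m | s <- Ss, m <- t s].
  rewrite size_allpairs_dep sumnE big_map; apply: eq_bigr => s _.
  by rewrite size_filter rough_countE.
rewrite -size_filter; apply: uniq_leq_size.
  apply: allpairs_uniq_dep => // [s _|]; first by rewrite filter_uniq ?iota_uniq.
  move=> _ _ /allpairsPdep[s1 [m1 [Ss1 tm1 ->]]] /allpairsPdep[s2 [m2 [Ss2 tm2 ->]]] /= eq12.
  have [_ sE1 mE1 _] := parts _ _ Ss1 tm1; have [_ sE2 mE2 _] := parts _ _ Ss2 tm2.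
  have eq_s : s1 = s2 by rewrite -sE1 eq12 sE2.
  by have -> : m1 = m2; [rewrite -mE1 eq12 mE2 | rewrite eq_s].
move=> _ /allpairsPdep[s [m [Ss_s tm ->]]].
have [n_bd _ mE m_le] := parts _ _ Ss_s tm.
by rewrite mem_filter mE m_le mem_iota; lia.
Qed.

(** * The demand and the available weight *)

(** The double sum of [demandE] with each minimum resolved by comparing [s] with [4 * u], so that
    each [s] and each [u] costs a single [rough_count]. *)
Definition demand (Us Ss : seq nat) (N : nat) : nat :=
  \sum_(s <- Ss) count (fun u => 4 * u < s) Us * rough_count (N %/ s)
  + \sum_(u <- Us) count (fun s => s <= 4 * u) Ss * rough_count ((N - 1) %/ (4 * u)).

Lemma demandE (Us Ss : seq nat) (N : nat) : 0 < N ->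
  (forall u, u \in Us -> 0 < u) -> (forall s, s \in Ss -> 0 < s) ->
  demand Us Ss N
    = \sum_(u <- Us) \sum_(s <- Ss) rough_count (minn (N %/ s) ((N - 1) %/ (4 * u))).
Proof.
move=> N_gt0 Us_gt0 Ss_gt0; rewrite /demand.
under eq_bigr do rewrite -sum1_count big_distrl big_mkcond /=.
rewrite exchange_big.
under [X in _ + X]eq_bigr do rewrite -sum1_count big_distrl big_mkcond /=.
rewrite -big_split [LHS]big_seq [RHS]big_seq; apply: eq_bigr => u /Us_gt0 u_gt0.
rewrite -big_split [LHS]big_seq [RHS]big_seq.
apply: eq_bigr => s /Ss_gt0 s_gt0 /=; rewrite !mul1n.
have u4_gt0 : 0 < 4 * u by lia.
case: leqP => [le_s|lt_s]; rewrite ?add0n ?addn0; congr rough_count.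
  apply/esym/minn_idPr; apply: leq_trans _ (leq_div2l _ s_gt0 le_s).
  by rewrite leq_div2r // leq_subr.
(* The strict inequality [4 * u < s] pays for the 1 subtracted from [N]. *)
apply/esym/minn_idPl; rewrite leq_divRL //.
have := leq_divM N s; move: (N %/ s) => q; nia.
Qed.

Lemma demand_le_weight_fact (Us Ss : seq nat) (K N t : nat) :
  0 < N -> N <= 4 * t -> subfactorization23 N t ->
  uniq Ss -> (forall s, s \in Ss -> smooth3 s) ->
  Us = map (val23 \o weight_bound) (iota 0 K) ->
  demand Us Ss N <= weight N`!.
Proof.
move=> N_gt0 le_Nt [l [l_smooth l_dvd l_ge]] uniqS smoothS def_Us.
have Us_gt0 u : u \in Us -> 0 < u.
  by rewrite def_Us => /mapP[k _ ->]; apply: val23_gt0.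
have Ss_gt0 s : s \in Ss -> 0 < s.
  by case/smoothS=> a [b ->]; rewrite muln_gt0 !expn_gt0.
rewrite demandE //.
(* Outside the range [l] may vanish, whereas [weight_prod] wants positive factors everywhere. *)
pose l' n := if 1 <= n <= N then l n else 1.
have l'_smooth n : smooth3 (l' n).
  by rewrite /l'; case: ifP => [/l_smooth //|_]; exists 0, 0.
have l'_gt0 n : 0 < l' n.
  by case: (l'_smooth n) => a [b ->]; rewrite muln_gt0 !expn_gt0.
have prod_dvd : \prod_(1 <= n < N.+1) l' n %| N`!.
  have -> : \prod_(1 <= n < N.+1) l' n = \prod_(1 <= n < N.+1) l n.
    by apply: eq_big_nat => n; rewrite ltnS /l' => ->.
  apply: dvdn_trans l_dvd _; rewrite fact_prod.
  by apply: (big_ind2 (fun a b => a %| b)) => // [*|n _]; rewrite ?dvdn_mul ?dvdn_part.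
apply: leq_trans _ (weight_dvd (fact_gt0 N) prod_dvd); rewrite weight_prod //.
(* Double counting of the pairs (n, u) with 4 u m_n < N: by [n] for the upper bound, by [u] for the
   lower one. *)
apply: (@leq_trans (\sum_(1 <= n < N.+1)
    count (fun u => 4 * u * rough_part n < N) Us)); last first.
  rewrite !big_nat; apply: leq_sum => n; rewrite ltnS => n_bd.
  apply: leq_trans _ (count_weight_bound_lt K (l'_smooth n)).
  rewrite def_Us count_map; apply: sub_count => k /= lt_N.
  have : 4 * t <= 4 * (l n * rough_part n) by rewrite leq_mul2l l_ge ?orbT.
  move/(leq_trans le_Nt)/(leq_trans lt_N).
  by rewrite mulnA ltn_mul2r ltn_mul2l /l' n_bd => /andP[].
under [X in _ <= X]eq_bigr do rewrite -sum1_count big_mkcond /=.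
rewrite [X in _ <= X]exchange_big /= big_seq [X in _ <= X]big_seq.
apply: leq_sum => u /Us_gt0 u_gt0.
apply: leq_trans (count_rough_part_ge N _ uniqS smoothS) _.
rewrite -sum1_count big_mkcond /= /index_iota !subn1 /=.
apply: leq_sum => n _; rewrite leq_divRL; last by lia.
case: (leqP (rough_part n * _)) => // le_n; have -> // : 4 * u * rough_part n < N by lia.
Qed.

(** * Transfer to binary integers for computation *)

Local Arguments Z.of_nat : simpl never.
Local Arguments Z.opp : simpl never.
Local Arguments Z.add : simpl never.
Local Arguments Z.mul : simpl never.
Local Arguments Z.div : simpl never.
Local Arguments Z.div2 : simpl never.

Lemma Z_of_nat_expn (m n : nat) : Z.of_nat (m ^ n) = (Z.of_nat m ^ Z.of_nat n)%Z.
Proof.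
rewrite -Nat2Z.inj_pow; congr Z.of_nat; elim: n => // n IHn.
by rewrite expnS IHn.
Qed.

Lemma Z_of_nat_divn (m n : nat) : Z.of_nat (m %/ n) = (Z.of_nat m / Z.of_nat n)%Z.
Proof.
case: n => [|n]; first by rewrite divn0; case: m.
apply: (Z.div_unique _ _ _ (Z.of_nat (m %% n.+1))).
  by have := ltn_mod m n.+1; lia.
by have := divn_eq m n.+1; lia.
Qed.

Lemma Z_of_nat_div2 (n : nat) : Z.of_nat (n %/ 2) = Z.div2 (Z.of_nat n).
Proof. by rewrite Z_of_nat_divn Z.div2_div. Qed.

Lemma Z_of_nat_div3 (n : nat) : Z.of_nat (n %/ 3) = (Z.of_nat n / 3)%Z.
Proof. exact: Z_of_nat_divn. Qed.

Definition val23Z (p : nat * nat) : Z := (2 ^ Z.of_nat p.1 * 3 ^ Z.of_nat p.2)%Z.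

Lemma val23ZE (p : nat * nat) : val23Z p = Z.of_nat (val23 p).
Proof. by rewrite /val23 Nat2Z.inj_mul !Z_of_nat_expn. Qed.

(* A pair (p, c) stands for the term [c * rough_count (x %/ val23 p)]. *)
Definition terms_sum (T : seq (nat * nat * nat)) (x : nat) : nat :=
  \sum_(t <- T) t.2 * rough_count (x %/ val23 t.1).

Lemma leq_terms_sum (T : seq (nat * nat * nat)) (x y : nat) :
  x <= y -> terms_sum T x <= terms_sum T y.
Proof.
move=> le_xy; apply: leq_sum => t _.
by rewrite leq_mul2l leq_rough_count ?orbT // leq_div2r.
Qed.

Definition smooth_terms (Us Ss : seq (nat * nat)) : seq (nat * nat * nat) :=
  [seq (s, count (fun u => (4 * val23Z u <? val23Z s)%Z) Us) | s <- Ss].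

(** The exponent [u.1.+2] absorbs the factor 4 of [4 * u]. *)
Definition bound_terms (Us Ss : seq (nat * nat)) : seq (nat * nat * nat) :=
  [seq ((u.1.+2, u.2), count (fun s => (val23Z s <=? 4 * val23Z u)%Z) Ss) | u <- Us].

Lemma demand_terms_sum (Us Ss : seq (nat * nat)) (N : nat) :
  demand (map val23 Us) (map val23 Ss) N
    = terms_sum (smooth_terms Us Ss) N + terms_sum (bound_terms Us Ss) (N - 1).
Proof.
rewrite /demand /terms_sum; congr (_ + _); rewrite big_map [RHS]big_map.
  apply: eq_bigr => s _; rewrite [in RHS]/fst [in RHS]/snd count_map; congr (_ * _).
  by apply: eq_count => u; rewrite /preim !val23ZE /=; case: Z.ltb_spec; lia.
apply: eq_bigr => u _; rewrite [in RHS]/fst [in RHS]/snd count_map; congr (_ * _).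
  by apply: eq_count => s; rewrite /preim !val23ZE /=; case: Z.leb_spec; lia.
by rewrite /val23 /= !expnS !mulnA.
Qed.

(** * Linear lower bounds for the demand *)

(** Over the common denominator D = 2^A 3^B, this is D times the sum of all c / [val23 p], hence 3D
    times the asymptotic slope of [terms_sum]. *)
Definition scaled_density (A B : nat) (T : seq (nat * nat * nat)) : Z :=
  foldr (fun t acc => Z.of_nat t.2 * val23Z (A - t.1.1, B - t.1.2)%N + acc)%Z 0%Z T.

Definition total_coef (T : seq (nat * nat * nat)) : Z :=
  foldr (fun t acc => Z.of_nat t.2 + acc)%Z 0%Z T.

(** Apply [rough_count_ge] to each term and multiply by c D / [val23 p]; the remainders 2 add up to
    the constant. *)
Lemma terms_sum_ge (A B : nat) (T : seq (nat * nat * nat)) (n x : nat) :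
  n <= x.+1 -> all (fun t => (t.1.1 <= A) && (t.1.2 <= B)) T ->
  (Z.of_nat n * scaled_density A B T
     <= val23Z (A, B) * (3 * Z.of_nat (terms_sum T x) + 2 * total_coef T))%Z.
Proof.
move=> le_nx; elim: T => [|[[a b] c] T IHT].
  by rewrite /terms_sum big_nil /=; lia.
rewrite [all _ _]/= => /andP[/andP[le_aA le_bB]] /IHT {IHT}.
rewrite /terms_sum big_cons -/(terms_sum T x) /= -/(scaled_density A B T) -/(total_coef T).
rewrite !val23ZE; set D := val23 (A, B); set e := val23 (A - a, B - b).
have D_eq : D = val23 (a, b) * e.
  by rewrite /D /e /val23 /= mulnACA -!expnD !subnKC.
have := rough_count_ge (val23_gt0 (a, b)) le_nx.
move: (rough_count _) (terms_sum _ _) (scaled_density _ _ _) (total_coef _) => r S P C n_le IH.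
have le_ceD : c * e * n <= D * (c * (3 * r + 2)).
  rewrite (leq_trans (leq_mul (leqnn (c * e)) n_le)) // D_eq; apply: eq_leq; lia.
nia.
Qed.

(** * Tables of coefficients of quotients by 3-smooth numbers *)

Fixpoint add_row (a : nat) (c : Z) (r : seq Z) : seq Z :=
  if a is a'.+1 then head 0%Z r :: add_row a' c (behead r)
  else (head 0%Z r + c)%Z :: behead r.

(** Entry [a] is the coefficient of [x %/ 2 ^ a]; each quotient is half the previous one, rounded
    down. Tables do the same with rows indexed by the power of 3. *)
Fixpoint row_value (r : seq Z) (x : Z) : Z :=
  if r is z :: r' then (z * x + row_value r' (Z.div2 x))%Z else 0%Z.

Lemma row_value_add (a : nat) (c : Z) (r : seq Z) (x : nat) :
  row_value (add_row a c r) (Z.of_nat x)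
    = (row_value r (Z.of_nat x) + c * Z.of_nat (x %/ 2 ^ a))%Z.
Proof.
elim: a r x => [|a IHa] r x /=; first by rewrite expn0 divn1; case: r => [|z r] /=; lia.
rewrite -Z_of_nat_div2 IHa expnS divnMA; case: r => [|z r] /=; first by lia.
by rewrite -Z_of_nat_div2; lia.
Qed.

Fixpoint add_cell (p : nat) (a : nat) (c : Z) (t : seq (seq Z)) : seq (seq Z) :=
  if p is b.+1 then head [::] t :: add_cell b a c (behead t)
  else add_row a c (head [::] t) :: behead t.

Fixpoint table_value (t : seq (seq Z)) (x : Z) : Z :=
  if t is r :: t' then (row_value r x + table_value t' (x / 3))%Z else 0%Z.

Lemma table_value_add (b a : nat) (c : Z) (t : seq (seq Z)) (x : nat) :
  table_value (add_cell b a c t) (Z.of_nat x)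
    = (table_value t (Z.of_nat x) + c * Z.of_nat (x %/ (2 ^ a * 3 ^ b)))%Z.
Proof.
elim: b t x => [|b IHb] t x.
  by rewrite expn0 muln1; case: t => [|r t] /=; rewrite row_value_add /=; lia.
rewrite /= -Z_of_nat_div3 IHb expnS mulnCA (divnMA x 3); case: t => [|r t] /=; first by lia.
by rewrite -Z_of_nat_div3; lia.
Qed.

(* [rough_count x = x - x %/ 2 - x %/ 3 + x %/ 6] turns every term into four quotients of x
   by 3-smooth numbers; summing their coefficients, most of them cancel. *)
Definition table (T : seq (nat * nat * nat)) : seq (seq Z) :=
  foldr (fun t acc => let: (a, b, c) := t in let z := Z.of_nat c in
    add_cell b a z (add_cell b a.+1 (- z) (add_cell b.+1 a (- z) (add_cell b.+1 a.+1 z acc))))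
    [::] T.

Lemma table_valueE (T : seq (nat * nat * nat)) (x : nat) :
  table_value (table T) (Z.of_nat x) = Z.of_nat (terms_sum T x).
Proof.
elim: T => [|[[a b] c] T IHT]; first by rewrite /terms_sum big_nil.
set z := Z.of_nat c.
have -> : table ((a, b, c) :: T) = add_cell b a z (add_cell b a.+1 (- z)
    (add_cell b.+1 a (- z) (add_cell b.+1 a.+1 z (table T)))) by [].
rewrite !table_value_add IHT /terms_sum big_cons -/(terms_sum T x) /z.
have -> : val23 (a, b, c).1 = 2 ^ a * 3 ^ b by [].
have divE d e : e = 2 ^ a * 3 ^ b * d -> x %/ e = x %/ (2 ^ a * 3 ^ b) %/ d.
  by move->; rewrite divnMA.
rewrite (divE 2 (2 ^ a.+1 * 3 ^ b)) ?(divE 3 (2 ^ a * 3 ^ b.+1)); try by rewrite !expnS; lia.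
rewrite (divE 6 (2 ^ a.+1 * 3 ^ b.+1)); last by rewrite !expnS; lia.
move: (x %/ _) => y; rewrite /rough_count [(a, b, c).2]/=.
have : c * ((y + 5) %/ 6 + (y + 1) %/ 6) + c * (y %/ 2) + c * (y %/ 3) = c * y + c * (y %/ 6).
  by rewrite -!mulnDr; congr (c * _); lia.
lia.
Qed.

(** * Legendre's formula and the weight of a factorial *)

Lemma logn_fact_div (p n : nat) : prime p ->
  logn p n`! = n %/ p + logn p (n %/ p)`!.
Proof.
move=> p_pr; have p_gt1 := prime_gt1 p_pr; rewrite !logn_fact //.
case: n => [|n]; first by rewrite div0n !big_geq.
rewrite big_nat_recl // expn1; congr (_ + _).
(* After the shift of index, the terms with exponent above [n.+1 %/ p] vanish. *)
rewrite (@big_cat_nat _ _ _ (n.+1 %/ p).+1) ?ltn_Pdiv //= [X in _ + X]big_nat_cond.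
rewrite [X in _ + X]big1 ?addn0; first by apply: eq_bigr => k _; rewrite expnS divnMA.
move=> k /andP[/andP[lt_k _] _]; rewrite expnS divnMA divn_small //.
by apply: ltn_trans lt_k _; apply: ltn_expl.
Qed.

(** Induction along [logn_fact_div]: with q = [n %/ p], the left side is at most (p - 1) q + q = p
    q. *)
Lemma logn_fact_le (p n : nat) : prime p -> (p - 1) * logn p n`! <= n.
Proof.
move=> p_pr; have p_gt1 := prime_gt1 p_pr.
have [k] := ubnP n; elim: k n => // k IHk [|n] lt_nk; first by rewrite fact0 logn1 muln0.
rewrite logn_fact_div //; have := IHk (n.+1 %/ p).
have /[swap] /[apply] : n.+1 %/ p < k by apply: leq_trans (ltn_Pdiv p_gt1 _) _.
by have := leq_divM n.+1 p; nia.
Qed.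

Lemma weight_fact_le (n : nat) : 2 * weight n`! <= 7 * n.
Proof.
have := @logn_fact_le 2 n isT; have := @logn_fact_le 3 n isT.
by rewrite /weight; lia.
Qed.

Lemma leq_weight_fact (m n : nat) : m <= n -> weight m`! <= weight n`!.
Proof.
move=> le_mn; apply: weight_dvd (fact_gt0 n) _.
by rewrite -(bin_fact le_mn) mulnCA dvdn_mulr.
Qed.

Fixpoint legendre (fuel : nat) (quo : Z -> Z) (n : Z) : Z :=
  if fuel is f.+1 then let q := quo n in (q + legendre f quo q)%Z else 0%Z.

Lemma legendreE (fuel p : nat) (quo : Z -> Z) (n : nat) :
  prime p -> (forall m, Z.of_nat (m %/ p) = quo (Z.of_nat m)) -> n < p ^ fuel ->
  legendre fuel quo (Z.of_nat n) = Z.of_nat (logn p n`!).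
Proof.
move=> p_pr quoE; elim: fuel n => [|f IHf] n.
  by rewrite expn0 ltnS leqn0 => /eqP->; rewrite logn1.
rewrite expnS mulnC => n_lt /=; rewrite -quoE IHf ?ltn_divLR ?prime_gt0 //.
by rewrite (@logn_fact_div p n) ?Nat2Z.inj_add.
Qed.

(** The fuels suffice below 2^22 < 3^14. *)
Definition weight_factZ (n : Z) : Z :=
  (2 * legendre 22 Z.div2 n + 3 * legendre 14 (fun m => m / 3) n)%Z.

Lemma weight_factZE (n : nat) : (Z.of_nat n < 2 ^ 22)%Z ->
  weight_factZ (Z.of_nat n) = Z.of_nat (weight n`!).
Proof.
move=> n_lt; have n_lt2 : n < 2 ^ 22.
  by have := Z_of_nat_expn 2 22; change (Z.of_nat 22) with 22%Z; lia.
have n_lt3 : n < 3 ^ 14.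
  by have := Z_of_nat_expn 3 14; change (Z.of_nat 14) with 14%Z; lia.
rewrite /weight_factZ (@legendreE _ 2 _ _ _ Z_of_nat_div2) //.
by rewrite (@legendreE _ 3 _ _ _ Z_of_nat_div3) // /weight; lia.
Qed.

(** * Comparing demand and available weight on intervals *)

(** Only a search for a long interval; [dominates] tests the result again. *)
Fixpoint jump (fuel : nat) (d lo k : Z) : Z :=
  if fuel is f.+1 then
    if (weight_factZ (lo + k) <? d)%Z then (lo + k)%Z else jump f d lo (7 * k / 8)%Z
  else lo.

Local Arguments jump : simpl never.

(* One evaluation [d] of the demand at [lo] settles all of [lo, hi] as soon as
   [weight_factZ hi < d]; the guess for [hi] comes from [weight n`!] being about 7n/2. *)
Fixpoint dominates (fuel : nat) (t1 t2 : seq (seq Z)) (top lo : Z) : bool :=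
  if (top <=? lo)%Z then true else
  if fuel is f.+1 then
    let d := (table_value t1 lo + table_value t2 (lo - 1))%Z in
    let hi := jump 30 d lo (2 * (d - weight_factZ lo) / 7)%Z in
    [&& (lo <=? hi)%Z, (hi <? 2 ^ 22)%Z, (weight_factZ hi <? d)%Z
      & dominates f t1 t2 top (hi + 1)%Z]
  else false.

(** Both sides are monotone: on an interval the demand is at least its value at [lo], and the weight
    of [n!] at most its value at [hi]. *)
Lemma dominatesP (fuel : nat) (T1 T2 : seq (nat * nat * nat)) (top lo : Z) (n : nat) :
  dominates fuel (table T1) (table T2) top lo ->
  (0 < lo)%Z -> (lo <= Z.of_nat n < top)%Z ->
  weight n`! < terms_sum T1 n + terms_sum T2 (n - 1).
Proof.
elim: fuel lo => [|f IHf] lo /=; case: Z.leb_spec => //; try lia.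
move=> lt_top /and4P[]; set hi := jump _ _ _ _.
move=> /Z.leb_spec0 le_hi /Z.ltb_spec0 hi_lt /Z.ltb_spec0 lt_d /IHf IH lo_gt0 n_bd.
have [n_le|n_gt] := Z.le_gt_cases (Z.of_nat n) hi; last by apply: IH; lia.
have [h hE] : exists h, hi = Z.of_nat h by exists (Z.to_nat hi); lia.
have [m mE] : exists m, lo = Z.of_nat m by exists (Z.to_nat lo); lia.
move: lt_d; rewrite hE weight_factZE; last by rewrite -hE.
have -> : (lo - 1)%Z = Z.of_nat (m - 1) by lia.
rewrite mE !table_valueE => lt_d.
have := @leq_terms_sum T1 m n; have := @leq_terms_sum T2 (m - 1) (n - 1).
by have := @leq_weight_fact n h; lia.
Qed.

(** * Numerical certificates beyond 26244 *)

(** The pair (0, 0) occurs for [k = 0] and [k = 1] and must count twice: 3-smooth numbers above 1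
    have weight at least 2. *)
Definition bounds : seq (nat * nat) := map weight_bound (iota 0 34).

(** All 3-smooth numbers up to 10^6, since 2^20 and 3^13 exceed it. *)
Definition smooths : seq (nat * nat) :=
  [seq p <- [seq (a, b) | a <- iota 0 21, b <- iota 0 14] | (val23Z p <=? 10 ^ 6)%Z].

Lemma demand_dominates :
  dominates (2 ^ 14) (table (smooth_terms bounds smooths))
    (table (bound_terms bounds smooths)) 2140000 26245.
Proof. by vm_compute. Qed.

(** With [terms_sum_ge], a demand of at most 7N/2 would give (2P - 21D) N <= 4DC, which the first
    two tests refute for N >= 2140000. *)
Lemma demand_tail : let D := val23Z (20, 13) in
  let T1 := smooth_terms bounds smooths in let T2 := bound_terms bounds smooths in
  let P := (scaled_density 20 13 T1 + scaled_density 20 13 T2)%Z in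
  let C := (total_coef T1 + total_coef T2)%Z in
  [&& (21 * D <? 2 * P)%Z, (4 * D * C <? (2 * P - 21 * D) * 2140000)%Z,
    all (fun t => (t.1.1 <= 20) && (t.1.2 <= 13)) T1
    & all (fun t => (t.1.1 <= 20) && (t.1.2 <= 13)) T2].
Proof. by vm_compute. Qed.

Lemma subfactorization23_lt (N t : nat) :
  (26244 < Z.of_nat N)%Z -> subfactorization23 N t -> 4 * t < N.
Proof.
move=> N_gt subN; rewrite ltnNge; apply/negP => le_N.
pose T1 := smooth_terms bounds smooths; pose T2 := bound_terms bounds smooths.
have : terms_sum T1 N + terms_sum T2 (N - 1) <= weight N`!.
  rewrite -demand_terms_sum.
  apply: (@demand_le_weight_fact _ _ 34 N t).
  - by lia.
  - exact: le_N.
  - exact: subN.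
  - by rewrite (map_inj_uniq val23_inj); vm_compute.
  - by move=> _ /mapP[p _ ->]; exists p.1, p.2.
  - by rewrite /bounds -map_comp.
have [N_lt|N_ge] := Z.lt_ge_cases (Z.of_nat N) 2140000.
  by rewrite leqNgt (dominatesP demand_dominates) //; lia.
have := weight_fact_le N.
have [] := and4P demand_tail; rewrite -/T1 -/T2.
move=> /Z.ltb_spec0 P_gt /Z.ltb_spec0 C_lt T1_le T2_le.
have := terms_sum_ge (leqnSn N) T1_le.
have N_le : N <= (N - 1).+1 by lia.
have := terms_sum_ge N_le T2_le.
move: P_gt C_lt; have : (0 < val23Z (20, 13)%N)%Z by [].
move: (val23Z _) (scaled_density _ _ T1) (scaled_density _ _ T2) (total_coef T1)
  (total_coef T2) (terms_sum _ _) (terms_sum _ _) => D P1 P2 C1 C2 S1 S2.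
move=> D_gt0 P_gt C_lt le2 le1 w_le S_le.
have : ((2 * (P1 + P2) - 21 * D) * 2140000 <= (2 * (P1 + P2) - 21 * D) * Z.of_nat N)%Z.
  by apply: Z.mul_le_mono_nonneg_l; lia.
have : (D * (2 * (Z.of_nat S1 + Z.of_nat S2)) <= D * (7 * Z.of_nat N))%Z.
  by apply: Z.mul_le_mono_nonneg_l; lia.
lia.
Qed.

(** * The explicit factorization for 26244 *)

Fixpoint strip (fuel : nat) (p n : Z) : Z :=
  if fuel is f.+1 then if (n mod p =? 0)%Z then strip f p (n / p) else n else n.

(** This holds for any fuel; that all factors 2 and 3 are gone is certified separately, by the gcd
    with 6 in [rough_partZE]. *)
Lemma strip_rough_part (fuel p n : nat) : p \in pi23 -> 0 < n -> 0 < p ->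
  exists k, [/\ strip fuel (Z.of_nat p) (Z.of_nat n) = Z.of_nat k, 0 < k
    & rough_part k = rough_part n].
Proof.
move=> p23 + p_gt0; elim: fuel n => [|f IHf] n n_gt0 /=; first by exists n.
case: Z.eqb_spec => [n_mod|_]; last by exists n.
rewrite -Z_of_nat_divn.
have n_eq : n = n %/ p * p.
  have := Z.div_mod (Z.of_nat n) (Z.of_nat p); rewrite n_mod -Z_of_nat_divn; nia.
have q_gt0 : 0 < n %/ p by move: n_gt0; rewrite {1}n_eq muln_gt0 => /andP[].
have [k [-> k_gt0 kE]] := IHf _ q_gt0; exists k; split=> //.
rewrite kE [in RHS]n_eq /rough_part partnM // (@part_p'nat _ p) ?muln1 //.
by rewrite pnatNK; move: p23; rewrite !inE => /orP[]/eqP->.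
Qed.

Definition rough_partZ (n : Z) : Z := strip 10 3 (strip 15 2 n).

Lemma rough_partZE (n : nat) : 0 < n ->
  Z.gcd (rough_partZ (Z.of_nat n)) 6 = 1%Z ->
  rough_partZ (Z.of_nat n) = Z.of_nat (rough_part n).
Proof.
move=> n_gt0; rewrite /rough_partZ -[2%Z]/(Z.of_nat 2) -[3%Z]/(Z.of_nat 3).
have [k [-> k_gt0 <-]] := @strip_rough_part 15 2 n isT n_gt0 isT.
have [m [-> m_gt0 <-]] := @strip_rough_part 10 3 k isT k_gt0 isT.
move=> m_cop; rewrite /rough_part part_pnat_id // -rough3E // /rough3 /coprime.
by apply/eqP; lia.
Qed.

(** For 3-rough [m] up to an entry's first component and above the preceding one, the pair encodes a
    3-smooth number of least weight reaching 6561 / m. Past 6559 the factor 1 is enough. *)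
Definition exps : seq (Z * (nat * nat)) :=
  zip [:: 1; 5; 7; 11; 13; 17; 19; 25; 29; 31; 37; 43; 49; 59; 67; 79;
          91; 101; 121; 133; 181; 205; 241; 271; 361; 409; 545; 727; 817;
          967; 1093; 1639; 2185; 3277; 6559]%Z
      [:: (0, 8); (1, 6); (2, 5); (3, 4); (9, 0); (4, 3); (7, 1); (5, 2);
          (0, 5); (3, 3); (6, 1); (1, 4); (4, 2); (7, 0); (2, 3); (5, 1);
          (0, 4); (3, 2); (6, 0); (1, 3); (4, 1); (2, 2); (5, 0); (0, 3);
          (3, 1); (1, 2); (4, 0); (2, 1); (0, 2); (3, 0); (0, 2); (1, 1);
          (2, 0); (0, 1); (1, 0)].

(* For [m <= 967] ties in weight are resolved towards powers of 2, beyond towards powers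
   of 3; 967 is where both exponents end up within those of 26244!, by 9 and by 2. *)
Definition exps_of (m : Z) : nat * nat :=
  foldr (fun '(top, p) acc => if (m <=? top)%Z then p else acc) (0, 0) exps.

Fixpoint Zrange (k : nat) (x : Z) : seq Z :=
  if k is j.+1 then x :: Zrange j (x + 1)%Z else [::].

Lemma ZrangeE (k n : nat) : Zrange k (Z.of_nat n) = map Z.of_nat (iota n k).
Proof.
elim: k n => //= k IHk n; congr (_ :: _); rewrite -IHk; congr (Zrange _ _); lia.
Qed.

Definition rough_parts (N : nat) : seq Z := map rough_partZ (Zrange N 1).

Lemma rough_partsE (N : nat) : all (fun m => (Z.gcd m 6 =? 1)%Z) (rough_parts N) ->
  rough_parts N = [seq Z.of_nat (rough_part n) | n <- iota 1 N].
Proof.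
rewrite /rough_parts (ZrangeE N 1) -map_comp all_map => /allP cop.
apply/eq_in_map => n n_in; apply: rough_partZE; first by move: n_in; rewrite mem_iota; lia.
by apply/Z.eqb_spec/cop.
Qed.

Lemma coprime_prod_rough_part (N p : nat) : p \in pi23 ->
  coprime p (\prod_(1 <= n < N.+1) rough_part n).
Proof.
move=> p23; rewrite big_seq; apply: (big_ind (coprime p)) => [|m n|n _].
- by rewrite coprimen1.
- by rewrite coprimeMr => -> ->.
apply: (@pnat_coprime pi23); last exact: part_pnat.
by move: p23; rewrite !inE => /orP[]/eqP->.
Qed.

(** [N!] is the product of the smooth parts times that of the rough parts, and the latter is coprime
    to 6; Gauss's lemma removes it. *)
Lemma dvdn_prod_smooth_part (N A B : nat) : 2 ^ A %| N`! -> 3 ^ B %| N`! ->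
  2 ^ A * 3 ^ B %| \prod_(1 <= n < N.+1) smooth_part n.
Proof.
move=> dvd2 dvd3.
have cop p : p \in pi23 -> coprime p (\prod_(1 <= n < N.+1) rough_part n).
  exact: coprime_prod_rough_part.
rewrite -(@Gauss_dvdl _ _ (\prod_(1 <= n < N.+1) rough_part n)).
  rewrite -big_split /= (eq_big_nat _ _ (F2 := id)) => [|n /andP[n_gt0 _]].
    by rewrite -fact_prod Gauss_dvd ?coprimeXl ?coprimeXr // dvd2 dvd3.
  by rewrite /smooth_part /rough_part partnC.
by rewrite coprimeMl !coprimeXl ?cop.
Qed.

Lemma exps_check : let ms := rough_parts 26244 in
  [&& all (fun m => (Z.gcd m 6 =? 1)%Z) ms,
      all (fun m => (6561 <=? val23Z (exps_of m) * m)%Z) ms,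
      (Z.of_nat (sumn [seq (exps_of m).1 | m <- ms]) <=? legendre 15 Z.div2 26244)%Z
    & (Z.of_nat (sumn [seq (exps_of m).2 | m <- ms]) <=?
         legendre 10 (fun m => m / 3) 26244)%Z].
Proof. by vm_compute. Qed.

(** Here 6561 = 26244 / 4. Variables with equations keep the numerals from unfolding in unary. *)
Lemma subfactorization23_26244 (N t : nat) :
  N = 26244 -> Z.of_nat t = 6561%Z -> subfactorization23 N t.
Proof.
move=> def_N def_t; have N_Z : Z.of_nat N = 26244%Z by rewrite def_N.
move: exps_check; cbv zeta; rewrite -def_N -N_Z -def_t.
move=> /and4P[/rough_partsE ->]; rewrite all_map => /allP ge_t.
have N_lt2 : N < 2 ^ 15 by have := Z_of_nat_expn 2 15; change (Z.of_nat 15) with 15%Z; lia.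
have N_lt3 : N < 3 ^ 10 by have := Z_of_nat_expn 3 10; change (Z.of_nat 10) with 10%Z; lia.
rewrite (@legendreE _ 2 _ _ _ Z_of_nat_div2) // (@legendreE _ 3 _ _ _ Z_of_nat_div3) //.
rewrite -!map_comp !sumnE !big_map => /Z.leb_spec0 le2 /Z.leb_spec0 le3.
pose e n := exps_of (Z.of_nat (rough_part n)).
exists (fun n => val23 (e n)); split.
- by move=> n _; exists (e n).1, (e n).2.
- rewrite /val23 big_split /= -!expn_sum; apply: dvdn_prod_smooth_part.
    rewrite pfactor_dvdn ?fact_gt0 // /index_iota subn1.
    by apply/ssrnat.leP/Nat2Z.inj_le; exact: le2.
  rewrite pfactor_dvdn ?fact_gt0 // /index_iota subn1.
  by apply/ssrnat.leP/Nat2Z.inj_le; exact: le3.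
move=> n n_bd; have n_in : n \in iota 1 N by rewrite mem_iota; lia.
have /Z.leb_spec0 := ge_t n n_in.
by rewrite val23ZE -/(e n); lia.
Qed.

Local Open Scope ring_scope.

Theorem theorem1p3 :
  26244%:R / 4%:R <= (t23 26244)%:R :> rat /\
  (forall N : nat, (26244 < N)%N -> (t23 N)%:R < N%:R / 4%:R :> rat).
Proof.
have [N0 N0_eq] : exists n, n = 26244%N by exists 26244%N.
have N0_Z : Z.of_nat N0 = 26244%Z by rewrite N0_eq.
rewrite -N0_eq; split=> [|N N_gt].
  rewrite ler_pdivrMr ?ltr0n // -natrM ler_nat.
  have N0_gt0 : (0 < N0)%N by lia.
  have [t t_Z] : exists t, Z.of_nat t = 6561%Z by exists (Z.to_nat 6561).
  have := (t23P N0_gt0).2 t (subfactorization23_26244 N0_eq t_Z); lia.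
rewrite ltr_pdivlMr ?ltr0n // -natrM ltr_nat mulnC.
have N_gt0 : (0 < N)%N by lia.
by apply: subfactorization23_lt (t23P N_gt0).1; lia.
Qed.
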